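(* Let $\lambda$ be a regular cardinal carrying a uniform, normal, $\kappa$-saturated ideal $I$ for some cardinal $\kappa<\lambda$, and let $\chi<\lambda$ be a regular cardinal. Then for every $k<\lambda$, the families $NS^k_\lambda$, $NS^{(k,\chi)}_\lambda$ and $NS^{k,d}_\lambda$ are all proper ideals on $\lambda$. In particular, $\lambda$ is $\lambda$-stationary, $(\lambda,\chi)$-$s$-stationary, and $\lambda$-$d$-stationary.
   Context: An ideal $I$ on a regular cardinal $\lambda$ is uniform if it contains all subsets of $\lambda$ of size $<\lambda$; normal if for any $\langle A_i:i<\lambda\rangle\subseteq I$ the diagonal union $\{\alpha<\lambda:\exists i<\alpha,\ \alpha\in A_i\}$ is in $I$; $\kappa$-saturated if for any $\kappa$ many $I$-positive sets $\langle B_j:j<\kappa\rangle$ there are $j_0\ne j_1$ with $B_{j_0}\cap B_{j_1}\notin I$. Higher-order stationarity (Bagaria). For an ordinal $\alpha$ and $A\subseteq\alpha$: $A$ is $0$-stationary in $\alpha$ iff $\sup(A)=\alpha$; for $\xi>0$, $A$ is $\xi$-stationary in $\alpha$ iff for every $\eta<\xi$ and every $S\subseteq\alpha$ $\eta$-stationary in $\alpha$ there is $\beta\in A$ with $S\cap\beta$ $\eta$-stationary in $\beta$. For a regular cardinal $\chi$: $A\subseteq\alpha$ is $(0,\chi)$-$s$-stationary in $\alpha$ iff unbounded in $\alpha$ with cofinality of $A$ at least $\chi$; for $\xi>0$, $A$ is $(\xi,\chi)$-$s$-stationary in $\alpha$ iff for every $\chi'<\chi$ and every $\langle T_i:i<\chi'\rangle$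 with each $T_i\subseteq\alpha$ $(\eta_i,\chi)$-$s$-stationary in $\alpha$ for some $\eta_i<\xi$, there is $\beta\in A$ with $T_i\cap\beta$ $(\eta_i,\chi)$-$s$-stationary in $\beta$ for all $i<\chi'$. $A\subseteq\alpha$ is $0$-$d$-stationary in $\alpha$ iff unbounded in $\alpha$; for $\xi>0$, $A$ is $\xi$-$d$-stationary in $\alpha$ iff for every $\langle T_i:i<\alpha\rangle$ with each $T_i\subseteq\alpha$ $\eta_i$-$d$-stationary in $\alpha$ for some $\eta_i<\xi$, there is $\beta\in A$ with $T_i\cap\beta$ $\eta_i$-$d$-stationary in $\beta$ for all $i<\beta$. An ordinal is $\xi$-(resp. $(\xi,\chi)$-$s$-, $\xi$-$d$-)stationary if it is so in itself. $NS^k_\lambda$, $NS^{(k,\chi)}_\lambda$, $NS^{k,d}_\lambda$ denote the families of subsets of $\lambda$ which are not $k$-stationary, not $(k,\chi)$-$s$-stationary, not $k$-$d$-stationary in $\lambda$, respectively; proper means not equal to $\mathcal{P}(\lambda)$.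
   Formalization: The ideal I is assumed proper, and stationarity of each kind is considered only in, and reflected only at, nonzero limit ordinals; read literally, {0,1} would be 2-stationary in λ while {0} and {1} are not, so NS² would not be an ideal. *)

(* Defs.v *)
From HB Require Import structures.
From mathcomp Require Import all_boot all_order.
From mathcomp Require Import boolp classical_sets functions cardinality.

Set Implicit Arguments.
Unset Strict Implicit.
Unset Printing Implicit Defensive.

Import Order.TTheory.

Local Open Scope classical_set_scope.
Local Open Scope card_scope.
Local Open Scope order_scope.

(* Ordinals are the elements of an arbitrary well-ordered type [W] (think of
   [W] as any ordinal greater than all the ordinals under consideration).  As
   with von Neumann ordinals, an ordinal [a] is identified with the set
   [seg a] of its predecessors, and a subset of [a] is an [A : set W] with
   [A `<=` seg a]; in particular the intersection of [S] and [b] is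
   [S `&` seg b]. *)

Definition seg d (W : porderType d) (a : W) : set W := [set x | x < a].

Definition is_zero d (W : porderType d) (a : W) : Prop := forall b, ~ (b < a).

Definition is_limit d (W : porderType d) (a : W) : Prop :=
  ~ is_zero a /\ forall b, b < a -> exists2 c, b < c & c < a.

Definition is_cardinal d (W : porderType d) (a : W) : Prop :=
  forall b, b < a -> ~ (seg b #= seg a).

Definition unbounded_in d (W : porderType d) (a : W) (A : set W) : Prop :=
  forall b, b < a -> exists2 c, A c & b <= c.

Definition cofinal d (W : porderType d) (A B : set W) : Prop :=
  B `<=` A /\ forall a, A a -> exists2 b, B b & a <= b.

(* The cofinality of [A] is at least the cardinal [mu]. *)
Definition cof_ge d (W : porderType d) (A : set W) (mu : W) : Prop :=
  forall B, cofinal A B -> seg mu #<= B.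

Definition is_regular d (W : porderType d) (a : W) : Prop :=
  [/\ is_cardinal a, infinite_set (seg a) & cof_ge (seg a) a].

Section Ideals.
Context d (W : porderType d).
Implicit Types (lam kappa : W) (I : set (set W)).

Definition powerset_of lam : set (set W) := [set A | A `<=` seg lam].

Definition is_ideal lam I : Prop :=
  [/\ I `<=` powerset_of lam,
      I set0,
      forall A B, I B -> A `<=` B -> I A
    & forall A B, I A -> I B -> I (A `|` B)].

Definition proper_ideal lam I : Prop :=
  is_ideal lam I /\ I <> powerset_of lam.

Definition positive lam I (B : set W) : Prop := B `<=` seg lam /\ ~ I B.

Definition uniform_ideal lam I : Prop :=
  forall A, A `<=` seg lam -> ~ (seg lam #<= A) -> I A.

Definition normal_ideal lam I : Prop :=
  forall A : W -> set W, (forall i, i < lam -> I (A i)) ->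
    I [set a | a < lam /\ exists2 i, i < a & A i a].

Definition saturated_ideal lam kappa I : Prop :=
  forall B : W -> set W, (forall j, j < kappa -> positive lam I (B j)) ->
    exists j0 j1, [/\ j0 < kappa, j1 < kappa, j0 <> j1 & ~ I (B j0 `&` B j1)].

End Ideals.

Section Stationarity.
Context d (W : orderType d) (wfW : well_founded (fun x y : W => x < y)).

(* [St eta a A] reads: [A] is eta-stationary in [a]. *)
Let notion := W -> W -> set W -> Prop.

Definition below (xi : W) (rec : forall eta, eta < xi -> W -> set W -> Prop)
    : notion :=
  fun eta a A => exists h : eta < xi, rec eta h a A.

(* The three notions of stationarity are defined by well-founded recursion on
   xi.  [base a A] is the clause for xi = 0, and [step St a A] is the clause
   for xi > 0, where [St] is the notion being defined restricted to indices
   eta < xi; see [hierarchyE].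
   As usual for higher stationarity, the ordinals in which a set may be
   stationary, and the ordinals at which reflection takes place, are the
   (nonzero) limit ordinals.  Otherwise every set, even the empty one, would
   vacuously be 1-stationary in every successor ordinal, {0,1} would be
   2-stationary in every infinite cardinal although {0} and {1} are not, and
   every set containing 0 would be xi-d-stationary for all xi > 0. *)
Definition hierarchy (base : W -> set W -> Prop)
    (step : notion -> W -> set W -> Prop) : notion :=
  Fix wfW (fun _ => W -> set W -> Prop) (fun xi rec a A =>
    [/\ is_limit a, A `<=` seg a,
        is_zero xi -> base a A
      & ~ is_zero xi -> step (below rec) a A]).

Lemma hierarchyE base step xi a A :
  hierarchy base step xi a A <->
  [/\ is_limit a, A `<=` seg a,
      is_zero xi -> base a A
    & ~ is_zero xi ->
      step (fun eta b B => eta < xi /\ hierarchy base step eta b B) a A].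
Proof.
rewrite {1}/hierarchy Fix_eq -/(hierarchy base step); last first.
  move=> x f g fg; suff -> : f = g by [].
  by apply: functional_extensionality_dep => y;
    apply: functional_extensionality_dep => h; exact: fg.
set r := below _; set s := fun eta => _.
suff -> : r = s by [].
apply/funext => eta; apply/funext => b; apply/funext => B; apply/propext.
by split=> [[h ?]|[h ?]]; [split | exists h].
Qed.

Definition reflects_at (A : set W) (P : W -> Prop) : Prop :=
  exists b, [/\ A b, is_limit b & P b].

Definition stationary : notion :=
  hierarchy
    (fun a A => supremums A a)
    (fun St a A => forall eta S, St eta a S ->
       reflects_at A (fun b => St eta b (S `&` seg b))).

(* (xi, chi)-s-stationarity; families are indexed by the ordinals chi' < chi. *)
Definition s_stationary (chi : W) : notion :=
  hierarchy
    (fun a A => unbounded_in a A /\ cof_ge A chi)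
    (fun St a A => forall chi', chi' < chi ->
       forall (T : W -> set W) (eta : W -> W),
       (forall i, i < chi' -> St (eta i) a (T i)) ->
       reflects_at A (fun b =>
         forall i, i < chi' -> St (eta i) b (T i `&` seg b))).

Definition d_stationary : notion :=
  hierarchy
    (fun a A => unbounded_in a A)
    (fun St a A => forall (T : W -> set W) (eta : W -> W),
       (forall i, i < a -> St (eta i) a (T i)) ->
       reflects_at A (fun b =>
         forall i, i < b -> St (eta i) b (T i `&` seg b))).

Definition NS (k lam : W) : set (set W) :=
  [set A | A `<=` seg lam /\ ~ stationary k lam A].

Definition NS_s (k chi lam : W) : set (set W) :=
  [set A | A `<=` seg lam /\ ~ s_stationary chi k lam A].

Definition NS_d (k lam : W) : set (set W) :=
  [set A | A `<=` seg lam /\ ~ d_stationary k lam A].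

Definition ord_stationary (xi a : W) : Prop := stationary xi a (seg a).

Definition ord_s_stationary (xi chi a : W) : Prop :=
  s_stationary chi xi a (seg a).

Definition ord_d_stationary (xi a : W) : Prop := d_stationary xi a (seg a).

End Stationarity.

(* Main.v *)
Require Import Defs.
From mathcomp Require Import all_boot all_order.
From mathcomp Require Import boolp classical_sets functions cardinality.

(* The filter F dual to I is normal, and by saturation every regressive
   function is F-almost everywhere bounded; write "a.e." for F-almost all.  The
   main claim is that a k-stationary subset S of lam reflects, i.e. S meets b
   in a k-stationary subset of b for a.e. b.  Then every set in F is
   k-stationary, and k-stationarity need only be tested on them: S is
   k-stationary iff it contains, for every E in F and eta < k, some b at which
   E is eta-stationary; this gives the ideals.
   If S did not reflect, then for positively many b there would be a witness
   X_b, eta-stationary in b for some eta < k, that is not reflected in S.  In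
   the generic extension by the I-positive sets, the X_b represent an
   eta-stationary X included in lam.  Since I generates an ideal satisfying the
   same hypotheses there, X reflects almost everywhere by induction, hence at
   all points of some E in F.  As S reflects E, it also reflects X, a
   contradiction.  Generic extensions are replaced below by product filters:
   the induction is carried out for families of sets X_w with w ranging over a
   product on which F x ... x F is considered. *)

Set Implicit Arguments.
Unset Strict Implicit.
Unset Printing Implicit Defensive.

Import Order.TTheory.

Local Open Scope order_scope.
Local Open Scope classical_set_scope.
Local Open Scope card_scope.

(** * Well-ordered types: least elements, unbounded sets, cofinality *)

Section WellOrder.
Context d (W : orderType d) (wfW : well_founded (fun x y : W => x < y)).
Implicit Types (a b c : W) (A B : set W).

Lemma wf_least (P : set W) : P !=set0 -> exists2 x, P x & forall y, P y -> x <= y.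
Proof.
move=> [x0 Px0]; apply: contrapT => noleast.
suff nP : forall x, ~ P x by exact: (nP x0).
apply: (well_founded_ind wfW) => x IH Px; apply: noleast; exists x => // y Py.
by rewrite leNgt; apply/negP => /IH.
Qed.

Lemma wf_zero a : exists2 z : W, is_zero z & forall x, z <= x.
Proof.
have [|z _ zP] := @wf_least setT; first by exists a.
by exists z => [b|x]; [rewrite ltNge zP | exact: zP].
Qed.

Lemma is_zero_le a b : is_zero a -> a <= b.
Proof. by move=> a0; rewrite leNgt; apply/negP/a0. Qed.

Lemma not_zero_gt0 a b : ~ is_zero a -> is_zero b -> b < a.
Proof.
move=> a0 b0; rewrite lt_neqAle is_zero_le // andbT.
by apply/eqP => ba; apply: a0; rewrite -ba.
Qed.

Lemma unbounded_inP a A : is_limit a -> A `<=` seg a ->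
  unbounded_in a A <-> forall b, b < a -> exists2 c, A c & b < c.
Proof.
move=> [_ alim] Aa; split=> [Au b /alim[c bc ca]|Au b /Au[c Ac bc]].
  by have [x Ax cx] := Au _ ca; exists x => //; exact: lt_le_trans cx.
by exists c => //; exact: ltW.
Qed.

Lemma limit_supremumP a A : is_limit a -> A `<=` seg a ->
  supremums A a <-> unbounded_in a A.
Proof.
move=> alim Aa; split=> [[_ alub] b ba|Au].
  apply: contrapT => Ab; suff : a <= b by rewrite leNgt ba.
  apply: alub => x Ax; rewrite leNgt; apply/negP => bx.
  by apply: Ab; exists x => //; exact: ltW.
split=> [x /Aa /ltW//|y yA]; rewrite leNgt; apply/negP => ya.
have [c /yA cy yc] := (unbounded_inP alim Aa).1 Au _ ya.
by move: yc; rewrite ltNge cy.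
Qed.

(** Moving each point of an unbounded [B] up to a point of [A] gives a cofinal subset of [A] no
    larger than [B]. The right-hand side depends on [a] alone and can serve as the condition [R] for
    s-stationarity. *)
Lemma unbounded_in_cof_geP a (mu : W) A : A `<=` seg a -> unbounded_in a A ->
  cof_ge A mu <->
  forall B, B `<=` seg a -> unbounded_in a B -> seg mu #<= B.
Proof.
move=> Aa Au; split=> [Acof B Ba Bu|aA B [BA Bcof]]; last first.
  apply: aA => [x /BA /Aa//|b /Au[c Ac bc]].
  by have [x Bx cx] := Bcof _ Ac; exists x => //; exact: le_trans cx.
have /choice[e eP] : forall b, exists c, b < a -> A c /\ b <= c.
  move=> b; case: (pselect (b < a)) => [/Au[c Ac bc]|nba]; last by exists b.
  by exists c.
apply: card_le_trans (card_image_le e B); apply: Acof; split.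
  by move=> _ [b /Ba /eP[Aeb _] <-].
move=> x Ax; have [b Bb xb] := Bu _ (Aa _ Ax).
by exists (e b); [exists b | apply: le_trans xb (eP _ (Ba _ Bb)).2].
Qed.

(* Choosing successively new elements of [V], one either obtains an injection
   of [kap] or exhausts [V] before [kap]. *)
Lemma seg_injection_or_image (kap : W) (V : set W) :
  (exists2 f : W -> W, forall j, j < kap -> V (f j) &
     {in seg kap &, injective f}) \/
  exists2 j, j < kap & exists f : W -> W, V `<=` f @` seg j.
Proof.
pose F := Fix wfW (fun _ => W)
  (fun j rec => xget kap [set v | V v /\ forall i (h : i < j), rec i h <> v]).
have FE j : F j = xget kap (V `\` F @` seg j).
  rewrite {1}/F Fix_eq -/F; last first.
    move=> x f g fg; congr xget; apply/seteqP.
    by split=> v [Vv fv]; split=> // i h; [rewrite -fg | rewrite fg].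
  congr xget; apply/seteqP; split=> v [Vv Fv]; split=> //.
    by move=> [i ij]; exact: Fv.
  by move=> i ij Fi; apply: Fv; exists i.
have [[j jk VF]|noj] := pselect (exists2 j, j < kap & V `<=` F @` seg j).
  by right; exists j => //; exists F.
have FV j : j < kap -> (V `\` F @` seg j) (F j).
  move=> jk; rewrite FE; case: xgetP => // nV.
  case: noj; exists j => // v Vv; apply: contrapT => Fv.
  by apply: (nV v); split.
left; exists F => [j /FV[]//|i j]; rewrite !inE /seg /= => ik jk Fij.
have [ij|ji|//] := ltgtP i j.
  by case: (FV _ jk) => _ []; exists i.
by case: (FV _ ik) => _ []; exists j.
Qed.

End WellOrder.

(** * Regular cardinals *)

Section RegularCardinal.
Context d (W : orderType d) (wfW : well_founded (fun x y : W => x < y)).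
Context (lam : W) (lam_regular : is_regular lam).

Lemma regular_limit : is_limit lam.
Proof.
have [_ laminf lamcof] := lam_regular; split.
  move=> l0; apply: laminf; suff -> : seg lam = set0 by exact: finite_set0.
  by apply/seteqP; split=> // x /l0.
move=> b bl; apply: contrapT => nb; apply: laminf.
apply: (card_le_finite (B := [set b])); last exact: finite_set1.
apply: lamcof; split=> [_ ->//|a al]; exists b => //.
by rewrite leNgt; apply/negP => ba; apply: nb; exists a.
Qed.

Lemma regular_seg_nle (b : W) : b < lam -> ~ (seg lam #<= seg b).
Proof.
move=> bl lb; have [lamcard _ _] := lam_regular.
apply: (lamcard _ bl); apply/card_eqPle; split => //.
by apply: subset_card_le => x xb; exact: lt_trans bl.
Qed.

Lemma regular_bounded (th : W) (f : W -> W) : th < lam ->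
  (forall i, i < th -> f i < lam) ->
  exists2 r, r < lam & forall i, i < th -> f i < r.
Proof.
move=> thl fl; apply: contrapT => unb; have [_ _ lamcof] := lam_regular.
apply: (regular_seg_nle thl); apply: card_le_trans (card_image_le f _).
apply: lamcof; split=> [_ [i ith <-]|a al]; first exact: fl.
apply: contrapT => na; apply: unb; exists a => // i ith.
by rewrite ltNge; apply/negP => ai; apply: na; exists (f i) => //; exists i.
Qed.

End RegularCardinal.

(** * Filters closed under fewer than [lam] intersections *)

Section CompleteFilter.
Context d (W : orderType d) (lam : W).

Record complete_filter T (G : set (set T)) : Prop := CompleteFilter {
  cfT : G setT;
  cfS : forall A B : set T, A `<=` B -> G A -> G B;
  cfI : forall A B : set T, G A -> G B -> G (A `&` B);
  cf_lt : forall (th : W) (Q : W -> set T), th < lam ->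
    (forall i, i < th -> G (Q i)) -> G [set t | forall i, i < th -> Q i t] }.

(* [small K] stands for "K has cardinality less than lam"; this form makes
   closure under products immediate, without cardinal arithmetic. *)
Definition small (K : Type) : Prop :=
  (forall f : K -> W, (forall k, f k < lam) ->
     exists2 r, r < lam & forall k, f k < r) /\
  (forall T (G : set (set T)), complete_filter G -> forall Q : K -> set T,
     (forall k, G (Q k)) -> G [set t | forall k, Q k t]).

Lemma small_prod K L : small K -> small L -> small (K * L).
Proof.
move=> [Kb Kc] [Lb Lc]; split=> [f fl|T G cG Q GQ].
  have /choice[r rP] : forall k, exists r, r < lam /\ forall l, f (k, l) < r.
    by move=> k; have [r] := Lb _ (fun l => fl (k, l)); exists r.
  have [s sl rs] := Kb r (fun k => (rP k).1).
  by exists s => // -[k l]; exact: lt_trans ((rP k).2 l) (rs k).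
have := Kc _ _ cG (fun k => [set t | forall l, Q (k, l) t]).
move=> /(_ (fun k => Lc _ _ cG _ (fun l => GQ (k, l)))).
by apply: (cfS cG) => t Qt [k l]; exact: Qt.
Qed.

(** This is the trace of [G] on [B], read as a filter on all of [T]. It is improper if the
    complement of [B] is in [G], which [complete_filter] permits. *)
Lemma complete_filter_restrict T (G : set (set T)) (B : set T) :
  complete_filter G ->
  complete_filter [set Q : set T | G [set t | B t -> Q t]].
Proof.
move=> cG; split=> /=.
- by apply: cfS cG _ _ _ (cfT cG).
- by move=> P Q PQ; apply: (cfS cG) => t BP /BP /PQ.
- move=> P Q GP GQ; apply: cfS cG _ _ _ (cfI cG GP GQ).
  by move=> t [BP BQ] Bt; split; [exact: BP|exact: BQ].
- move=> th Q thl GQ; apply: cfS cG _ _ _ (cf_lt cG thl GQ).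
  by move=> t BQ Bt i /BQ; exact.
Qed.

Lemma complete_filter_prod T U (F : set (set T)) (G : set (set U)) :
  complete_filter F -> complete_filter G ->
  complete_filter [set Q : set (T * U) | F [set t | G [set u | Q (t, u)]]].
Proof.
move=> cF cG; split=> /=.
- by apply: cfS cF _ _ _ (cfT cF) => t _; apply: cfS cG _ _ _ (cfT cG).
- move=> P Q PQ; apply: (cfS cF) => t; apply: (cfS cG) => u; exact: PQ.
- move=> P Q FP FQ; apply: cfS cF _ _ _ (cfI cF FP FQ) => t [GP GQ].
  exact: cfS cG _ _ _ (cfI cG GP GQ).
- move=> th Q thl FQ; apply: cfS cF _ _ _ (cf_lt cF thl FQ) => t GQ.
  by have := @cf_lt _ _ cG th (fun i => [set u | Q i (t, u)]) thl GQ.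
Qed.

End CompleteFilter.

(** * Small index types *)

Section SmallSegment.
Context d (W : orderType d) (wfW : well_founded (fun x y : W => x < y)).
Context (lam : W) (lam_regular : is_regular lam).

Lemma small_seg (th : W) : th < lam -> small lam {i : W | i < th}.
Proof.
move=> thl; split=> [f fl|T G cG Q GQ].
  have [z z0 _] := wf_zero wfW lam.
  have zl := not_zero_gt0 (regular_limit lam_regular).1 z0.
  pose g i := match pselect (i < th) with
    left h => f (exist _ i h) | right _ => z end.
  have [|r rl gr] := @regular_bounded _ _ _ lam_regular th g thl.
    by move=> i ith; rewrite /g; case: pselect.
  exists r => // -[i ith]; have := gr i ith; rewrite /g; case: pselect => // h.
  by rewrite (Prop_irrelevance h ith).
pose P i := [set t | forall h : i < th, Q (exist _ i h) t].
have := @cf_lt _ _ _ _ _ cG th P thl.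
have GP i : i < th -> G (P i).
  move=> ith; apply: cfS cG _ _ _ (GQ (exist _ i ith)) => t Qt h.
  by rewrite (Prop_irrelevance h ith).
by move=> /(_ GP); apply: (cfS cG) => t Pt [i ith]; exact: Pt.
Qed.

Lemma small_unit : small lam unit.
Proof.
split=> [f fl|T G cG Q GQ].
  have [c fc cl] := (regular_limit lam_regular).2 _ (fl tt).
  by exists c => // -[].
by apply: cfS cG _ _ _ (GQ tt) => t Qt [].
Qed.

End SmallSegment.

(** * The filter dual to [I]: normality and saturation *)

Section SaturatedIdeal.
Context d (W : orderType d) (wfW : well_founded (fun x y : W => x < y)).
Context (lam kappa : W) (I : set (set W)).
Context (lam_regular : is_regular lam) (kappa_lam : kappa < lam)
  (I_ideal : proper_ideal lam I) (I_uniform : uniform_ideal lam I)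
  (I_normal : normal_ideal lam I) (I_saturated : saturated_ideal lam kappa I).

Definition ae (Q : set W) : Prop := I [set a | a < lam /\ ~ Q a].

Lemma ae_mono (P Q : set W) :
  (forall a, a < lam -> P a -> Q a) -> ae P -> ae Q.
Proof.
move=> PQ aP; have [[_ _ IS _] _] := I_ideal; apply: IS aP _ => a [al nQ].
by split=> // /(PQ _ al).
Qed.

Lemma ae_true (Q : set W) : (forall a, a < lam -> Q a) -> ae Q.
Proof.
move=> QP; have [[_ I0 _ _] _] := I_ideal.
rewrite /ae /= (_ : [set _ | _] = set0) //.
by apply/seteqP; split=> // a [/QP].
Qed.

Lemma ae_and (P Q : set W) : ae P -> ae Q -> ae (P `&` Q).
Proof.
have [[_ _ IS IU] _] := I_ideal => aP aQ.
apply: IS (IU _ _ aP aQ) _ => a [al /not_andP[nP|nQ]]; first by left.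
by right.
Qed.

Lemma ae_ex (Q : set W) : ae Q -> exists2 a, a < lam & Q a.
Proof.
move=> aQ; apply: contrapT => nQ; have [[Ilam _ IS _] []] := I_ideal.
apply/seteqP; split=> // A Al; apply: IS aQ _ => a /Al al.
by split=> // Qa; apply: nQ; exists a.
Qed.

Lemma ae_diag (Q : W -> set W) : (forall i, i < lam -> ae (Q i)) ->
  ae [set a | forall i, i < a -> Q i a].
Proof.
move=> aQ; have [[_ _ IS _] _] := I_ideal; apply: IS (I_normal aQ) _.
move=> a [al /existsNP[i /not_implyP[ia nQ]]]; split=> //.
by exists i => //; split.
Qed.

Lemma ae_gt (b : W) : b < lam -> ae [set a | b < a].
Proof.
move=> bl; apply: I_uniform => [a []//|lle].
have [c bc cl] := (regular_limit lam_regular).2 _ bl.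
apply: (regular_seg_nle lam_regular cl); apply: card_le_trans lle _.
by apply: subset_card_le => a [_ /negP]; rewrite -leNgt => /le_lt_trans; exact.
Qed.

Lemma ae_complete_filter : complete_filter lam ae.
Proof.
split.
- exact: ae_true.
- by move=> A B AB; apply: ae_mono => a _; exact: AB.
- exact: ae_and.
- move=> th Q thl aQ.
  (* Normality gives completeness: the family is extended trivially beyond [th], and above [th] its
     diagonal intersection is the plain one. *)
  have := ae_diag (Q := fun i => [set a | i < th -> Q i a]).
  have aQ' i : i < lam -> ae [set a | i < th -> Q i a].
    move=> _; case: (pselect (i < th)) => [ith|nth].
      by apply: ae_mono (aQ i ith) => a _ Qa _.
    by apply: ae_true => a _ /nth.
  move=> /(_ aQ') aQ''; apply: ae_mono (ae_and aQ'' (ae_gt thl)).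
  move=> a _ [Qa tha] i ith; apply: (Qa i) => //; exact: lt_trans tha.
Qed.

Lemma ae_closed (g : W -> W) : (forall b, b < lam -> g b < lam) ->
  ae [set a | forall b, b < a -> g b < a].
Proof. by move=> gl; apply: ae_diag => i il; exact: ae_gt (gl _ il). Qed.

Lemma ae_limit : ae (@is_limit _ W).
Proof.
have [nz lim] := regular_limit lam_regular.
have /choice[g gP] : forall b, exists c, b < lam -> b < c /\ c < lam.
  move=> b; case: (pselect (b < lam)) => [/lim[c bc cl]|nb]; last by exists b.
  by exists c.
have [z z0 _] := wf_zero wfW lam.
have := ae_and (ae_gt (not_zero_gt0 nz z0)) (ae_closed (fun b bl => (gP b bl).2)).
apply: ae_mono => a al [za ga]; split; first by move=> /(_ z).
move=> b ba; have bl := lt_trans ba al.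
by exists (g b); [exact: (gP b bl).1 | exact: ga].
Qed.

(** By normality [f] almost always takes a value in the set [V] of values with positive fibre. An
    injection of [kappa] into [V] would give [kappa] disjoint positive fibres, against saturation;
    so [V] is covered by the image of a segment below [kappa]. *)
Lemma ae_regressive (f : W -> W) : ae [set a | f a < a] ->
  exists D : {j : W | j < kappa} -> W,
    (forall k, D k < lam) /\ ae [set a | exists k, f a = D k].
Proof.
move=> fa; pose V := [set v | v < lam /\ ~ ae [set a | f a <> v]].
have faV : ae [set a | V (f a)].
  have := @ae_diag (fun v => [set a | ~ V v -> f a <> v]).
  have aV v : v < lam -> ae [set a | ~ V v -> f a <> v].
    move=> vl; case: (pselect (V v)) => Vv; first by apply: ae_true => a _ /(_ Vv).
    have fav : ae [set a | f a <> v].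
      by apply: contrapT => nfv; apply: Vv; split.
    by apply: ae_mono fav => a _ fa' _.
  move=> /(_ aV) aV'; apply: ae_mono (ae_and aV' fa) => a _ [aP fa'].
  by apply: contrapT => /(aP _ fa'); exact.
have [[e eV einj]|[j jk [h hV]]] := seg_injection_or_image wfW kappa V.
  have [[_ I0 IS _] _] := I_ideal.
  have pos j : j < kappa -> positive lam I [set a | a < lam /\ f a = e j].
    move=> /eV [_ nae]; split=> [a []//|If]; apply: nae.
    by apply: IS If _ => a [al /contrapT fa'].
  have [j0 [j1 [j0k j1k jneq []]]] := I_saturated pos.
  apply: IS I0 _ => a [[_ /= e0] [_ /= e1]]; case: jneq.
  by apply: einj; rewrite ?inE // -e0.
have [v Vv] : V !=set0 by have [a _ Va] := ae_ex faV; exists (f a).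
exists (fun k => if `[< V (h (sval k)) >] then h (sval k) else v); split.
  by move=> k; case: asboolP => [[]|_] //; exact: Vv.1.
apply: ae_mono faV => a _ Va; have [i ij hi] := hV _ Va.
exists (exist _ i (lt_trans ij jk)) => /=; rewrite hi.
by case: asboolP.
Qed.

End SaturatedIdeal.

(** * A common axiomatization of the three notions of stationarity *)

Section ReflectionNotion.
Context d (W : orderType d) (wfW : well_founded (fun x y : W => x < y)).
Context (chi lam : W).
Context (okP : set W) (N : W -> W -> set W) (R : set W)
  (St : W -> W -> set W -> Prop).

(* A family of shape [p] in [a] is indexed by [N p a].  For every [m < k] the
   constant family with value [E] is to be reflected with shape [q m] and
   indices [mu m j]; these cofinally exhaust the families of indices below k. *)
Record covering (k : W) (q : W -> W) (mu : W -> W -> W) : Prop := Covering {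
  cov_ok : forall m, m < k -> okP (q m);
  cov_lt : forall m j, m < k -> mu m j < k;
  cov_base : forall m g, m < k -> is_limit g ->
    exists2 j, N (q m) g j & is_zero (mu m j) \/ R g;
  cov_ge : forall p b (e : W -> W), okP p -> (forall i, N p b i -> e i < k) ->
    exists2 m, m < k & forall g, g < b -> chi < g -> k < g -> forall i,
      N p g i -> exists2 j, N (q m) g j & e i <= mu m j;
  cov_directed : forall m m', m < k -> m' < k -> exists2 m'', m'' < k &
    forall g j, N (q m) g j \/ N (q m') g j -> exists2 j', N (q m'') g j' &
      (N (q m) g j -> mu m j <= mu m'' j') /\
      (N (q m') g j -> mu m' j <= mu m'' j') }.

(* [R a] holds at those limits [a] that have 0-stationary subsets.  At other
   limits the s-hierarchy is not monotone in its index, e.g. if cf(a) < chi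
   every subset of [a] containing a limit is 1-s-stationary in [a]. *)
Record reflection_notion : Prop := ReflectionNotion {
  rn_eq : forall k a A, St k a A <->
    [/\ is_limit a, A `<=` seg a, is_zero k -> R a /\ unbounded_in a A
      & ~ is_zero k -> forall p, okP p -> forall (T : W -> set W) (e : W -> W),
        (forall i, N p a i -> e i < k /\ St (e i) a (T i)) ->
        reflects_at A (fun b => forall i, N p b i ->
          e i < k /\ St (e i) b (T i `&` seg b))];
  rn_ex : exists2 p, okP p & forall a, is_limit a -> N p a !=set0;
  rn_anti : forall p a b, okP p -> a <= b -> N p a `<=` N p b;
  rn_seg : forall p a, okP p -> is_limit a -> chi < a -> N p a `<=` seg a;
  rn_tail : (forall p a, okP p -> N p a `<=` seg chi) \/
    (forall a, is_limit a -> R a /\ forall p, okP p -> N p a !=set0);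
  rn_cov : forall k, k < lam -> ~ is_zero k -> exists q mu, covering k q mu }.

Context (rn : reflection_notion).

Lemma St_limit k a A : St k a A -> is_limit a.
Proof. by move=> /(rn_eq rn)[]. Qed.

Lemma St_seg k a A : St k a A -> A `<=` seg a.
Proof. by move=> /(rn_eq rn)[]. Qed.

Lemma St_zero k a (A : set W) : is_zero k -> St k a A -> R a /\ unbounded_in a A.
Proof. by move=> k0 /(rn_eq rn)[_ _ /(_ k0)]. Qed.

Lemma St_superset k a A B : A `<=` B -> B `<=` seg a -> St k a A -> St k a B.
Proof.
move=> AB Ba /(rn_eq rn)[alim Aa A0 A1]; apply/(rn_eq rn); split=> //.
  move=> /A0[Ra Au]; split=> // b /Au[c Ac bc].
  by exists c => //; exact: AB.
move=> k0 p okp T e eT; have [b [Ab blim bP]] := A1 k0 p okp T e eT.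
by exists b; split=> //; exact: AB.
Qed.

Lemma unbounded_limit_neq0 (a : W) (A : set W) : is_limit a -> unbounded_in a A -> A !=set0.
Proof.
move=> [az _] Au; have [z z0 _] := wf_zero wfW a.
by have [c Ac _] := Au _ (not_zero_gt0 az z0); exists c.
Qed.

(** For [k > 0], the part of [a] above [b] is 0-stationary because of [R a], and a point of [A]
    reflecting it exceeds [b]. *)
Lemma St_unbounded k a A : R a -> St k a A -> unbounded_in a A.
Proof.
move=> Ra /(rn_eq rn)[alim Aa A0 A1].
have [k0|k0] := pselect (is_zero k); first by have [] := A0 k0.
move=> b ba; have [z z0 _] := wf_zero wfW k; have zk := not_zero_gt0 k0 z0.
have [p okp Np] := rn_ex rn.
have [|g [Ag glim gP]] :=
    A1 k0 p okp (fun _ => [set x | x < a /\ b < x]) (fun _ => z).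
  move=> i _; split=> //; apply/(rn_eq rn); split=> // [x []//|_].
  split=> // c ca; have mca : Order.max b c < a by rewrite gt_max ba.
  have [x mx xa] := alim.2 _ mca; move: mx; rewrite gt_max => /andP[bx cx].
  by exists x => //; exact: ltW.
have [i Ni] := Np _ glim; have [_ Sg] := gP i Ni.
have [x [[_ bx] xg]] := unbounded_limit_neq0 glim (St_zero z0 Sg).2.
by exists g => //; apply: ltW; exact: lt_trans xg.
Qed.

Lemma St_mono k k' a A : R a -> k <= k' -> St k' a A -> St k a A.
Proof.
move=> Ra kk' SA; have [alim Aa _ A1] := (rn_eq rn _ _ _).1 SA.
apply/(rn_eq rn); split=> // [_|k0]; first by split; [|exact: St_unbounded SA].
have k'0 : ~ is_zero k'.
  by have [z z0 _] := wf_zero wfW k; move=> /(_ z); apply;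
    apply: lt_le_trans kk'; exact: not_zero_gt0.
move=> p okp T e eT; have [|b [Ab blim bP]] := A1 k'0 p okp T e.
  by move=> i /eT[ek]; split=> //; exact: lt_le_trans kk'.
have ba := Aa _ Ab; exists b; split=> // i Ni; split; last by have [] := bP i Ni.
by have [] := eT i (rn_anti rn okp (ltW ba) Ni).
Qed.

(** Induction on [k]: cutting the witnesses down to their parts above [b] forces the reflection
    point above [b], given [R] and a nonempty index set at that point. *)
Lemma St_tail k a b A :
  (forall a, is_limit a -> R a /\ forall p, okP p -> N p a !=set0) ->
  b < a -> St k a A -> St k a (A `&` [set x | b < x]).
Proof.
move=> good ba; move: k A; apply: (well_founded_ind wfW) => k IH A SA.
have [alim Aa _ A1] := (rn_eq rn _ _ _).1 SA; have Ra := (good a alim).1.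
apply/(rn_eq rn); split=> // [x [/Aa]//|_|k0 p okp T e eT].
  split=> // c ca; have mca : Order.max b c < a by rewrite gt_max ba.
  have [x Ax] := (unbounded_inP alim Aa).1 (St_unbounded Ra SA) _ mca.
  rewrite gt_max => /andP[bx cx].
  by exists x; [split | exact: ltW].
have [|g [Ag glim gP]] := A1 k0 p okp (fun i => T i `&` [set x | b < x]) e.
  by move=> i /eT[ek eS]; split=> //; exact: IH.
have gP' i : N p g i -> St (e i) g (T i `&` seg g).
  move=> Ni; have [_] := gP i Ni; apply: St_superset => [x [[Tx _] xg]|x []//].
  by split.
exists g; split=> // [|i Ni]; last by split; [have [] := gP i Ni | exact: gP'].
split=> //=; have [Rg Np] := good g glim; have [i Ni] := Np p okp.
have [_ Sg] := gP i Ni.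
have [x [[_ bx] xg]] := unbounded_limit_neq0 glim (St_unbounded Rg Sg).
exact: lt_trans xg.
Qed.

(** Two reflections: for [k > 0], a family reflects first at some [x] in [E], and then its traces on
    [x] reflect at a point of [Y] below [x]. *)
Lemma St_reflecting k g E Y : Y `<=` seg g -> St k g E ->
  (forall x, E x -> St k x (Y `&` seg x)) -> St k g Y.
Proof.
move=> Yg SE EY; have [glim Eg E0 E1] := (rn_eq rn _ _ _).1 SE.
apply/(rn_eq rn); split=> // [k0|k0 p okp T e eT].
  have [Rg Eu] := E0 k0; split=> // b bg.
  have [x Ex bx] := (unbounded_inP glim Eg).1 Eu _ bg.
  by have [c [Yc _] bc] := (St_zero k0 (EY x Ex)).2 _ bx; exists c.
have [x [Ex xlim xP]] := E1 k0 p okp T e eT.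
have [_ _ _ Y1] := (rn_eq rn _ _ _).1 (EY x Ex).
have [y [[Yy yx] ylim yP]] := Y1 k0 p okp (fun i => T i `&` seg x) e xP.
exists y; split=> // i Ni; have [ek Sy] := yP i Ni; split=> //=.
suff -> : T i `&` seg y = T i `&` seg x `&` seg y by [].
apply/seteqP; split=> [z [Tz zy]|z [[Tz _] zy]] //.
by split=> //; split=> //; exact: lt_trans yx.
Qed.

(** By [rn_tail], either [i < chi] and all of [E] lies above [i], or the part of [E] above [i] is as
    stationary as [E]. *)
Lemma St_reflecting_tail k g E Y p i : R g -> okP p -> N p g i -> i < g ->
  Y `<=` seg g -> E `<=` [set x | chi < x] -> St k g E ->
  (forall x, E x -> i < x -> St k x (Y `&` seg x)) -> St k g Y.
Proof.
move=> Rg okp Ni ig Yg Echi SE EY; case: (rn_tail rn) => [Nchi|good].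
  apply: St_reflecting Yg SE _ => x Ex; apply: EY => //.
  by apply: lt_trans (Echi _ Ex); exact: Nchi Ni.
by apply: St_reflecting Yg (St_tail good ig SE) _ => x [Ex ix]; exact: EY.
Qed.

(** One set [E] replaces a family of witnesses: each point of [E] reflects the members [T i], so the
    family reflects wherever [E] is sufficiently stationary. *)
Lemma reflect_family k q mu p (T : W -> set W) e E g m :
  covering k q mu -> okP p -> is_limit g -> m < k ->
  (forall x, E x -> x < g -> [/\ chi < x, k < x & forall i, i < x ->
     N p g i -> St (e i) x (T i `&` seg x)]) ->
  (chi < g -> k < g -> forall i, N p g i ->
     exists2 j, N (q m) g j & e i <= mu m j) ->
  (forall j, N (q m) g j -> St (mu m j) g (E `&` seg g)) ->
  forall i, N p g i -> St (e i) g (T i `&` seg g).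
Proof.
move=> cov okp glim mk EP covm Sg i Ni.
(* If the index given by [cov_base] is 0, then [R g] follows from the stationarity of [E] in [g]. *)
have Rg : R g.
  have [j Nj [m0|//]] := cov_base cov mk glim.
  by have [] := St_zero m0 (Sg j Nj).
have [j0 Nj0 _] := cov_base cov mk glim.
have [x [Ex xg]] := unbounded_limit_neq0 glim (St_unbounded Rg (Sg j0 Nj0)).
have [chix kx _] := EP x Ex xg.
have chig := lt_trans chix xg; have kg := lt_trans kx xg.
have [j Nj ej] := covm chig kg i Ni.
apply: (St_reflecting_tail Rg okp Ni _ _ _ (St_mono Rg ej (Sg j Nj))).
- exact: rn_seg Ni.
- by move=> y [].
- by move=> y [Ey /(EP y Ey)[]].
- move=> y [Ey yg] iy; have [_ _ yP] := EP y Ey yg.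
  suff -> : T i `&` seg g `&` seg y = T i `&` seg y by exact: yP.
  apply/seteqP; split=> [z [[Tz _] zy]|z [Tz zy]] //.
  by split=> //; split=> //; exact: lt_trans yg.
Qed.

End ReflectionNotion.

(** * Generic systems and reflection almost everywhere *)

Section GenericSystem.
Context d (W : orderType d) (wfW : well_founded (fun x y : W => x < y)).
Context (lam kappa chi : W) (I : set (set W)).
Context (lam_regular : is_regular lam) (kappa_lam : kappa < lam)
  (chi_lam : chi < lam)
  (I_ideal : proper_ideal lam I) (I_uniform : uniform_ideal lam I)
  (I_normal : normal_ideal lam I) (I_saturated : saturated_ideal lam kappa I).
Context (okP : set W) (N : W -> W -> set W) (R : set W)
  (St : W -> W -> set W -> Prop).
Context (rn : reflection_notion chi lam okP N R St).
Context (R_lam : R lam) (R_ae : ae lam I R).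

Notation ae := (ae lam I).
Let aeF : complete_filter lam ae :=
  ae_complete_filter lam_regular I_ideal I_uniform I_normal.

(* A filter [G] on [Omega] with [delta : Omega -> W] abstracts a generic
   embedding obtained by finitely many successive extensions by the dual of
   [I], in which [delta] represents lam; [gs_few] expresses the chain
   condition. *)
Record generic_system (Omega : Type) (G : set (set Omega)) (delta : Omega -> W)
    (K : Type) : Prop := GenericSystem {
  gs_filter : complete_filter lam G;
  gs_small : small lam K;
  gs_le : G [set w | delta w <= lam];
  gs_limit : G [set w | is_limit (delta w)];
  gs_R : G [set w | R (delta w)];
  gs_gt : forall b, b < lam -> G [set w | b < delta w];
  gs_closed : forall g : W -> W, (forall b, b < lam -> g b < lam) ->
    G [set w | forall b, b < delta w -> g b < delta w];
  gs_few : forall f : Omega -> W, G [set w | f w < delta w] ->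
    exists2 D : K -> W, forall k, D k < lam & G [set w | exists k, f w = D k] }.

(** This system stands for the ground model itself. *)
Lemma gs_point : generic_system [set Q : set unit | Q tt] (fun=> lam) unit.
Proof.
split=> //=.
- by split=> //= A B; exact.
- exact: small_unit.
- exact: regular_limit.
- by move=> f fl; exists (fun=> f tt) => //; exists tt.
Qed.

Lemma gs_restrict Omega G delta K (B : set Omega) :
  generic_system G delta K ->
  generic_system [set Q : set Omega | G [set w | B w -> Q w]] delta K.
Proof.
move=> gs; have cG := gs_filter gs; split=> /=.
- exact: complete_filter_restrict.
- exact: gs_small gs.
- by apply: (cfS cG _) (gs_le gs) => w /= wP _.
- by apply: (cfS cG _) (gs_limit gs) => w /= wP _.
- by apply: (cfS cG _) (gs_R gs) => w /= wP _.
- by move=> b bl; apply: (cfS cG _) (gs_gt gs bl) => w /= wP _.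
- by move=> g gl; apply: (cfS cG _) (gs_closed gs gl) => w /= wP _.
- move=> f Bf; have [z z0 _] := wf_zero wfW lam.
  have zl := not_zero_gt0 (regular_limit lam_regular).1 z0.
  (* Off [B] the function need not be regressive, so it is set to the least ordinal there. *)
  have [|D Dl DP] := gs_few gs (f := fun w => if `[< B w >] then f w else z).
    apply: (cfS cG _) (cfI cG Bf (gs_gt gs zl)) => w [/= fB zd].
    by case: asboolP.
  exists D => //; apply: (cfS cG _) DP => w /= [k fk] Bw; exists k.
  by move: fk; case: asboolP.
Qed.

(** One further extension, whose new coordinate [b] represents [lam]. For almost all [b], [f (b, _)]
    has few values [D b k < b]; for fixed [k], [D b k] is regressive in [b] and has few values by
    [ae_regressive]. *)
Lemma gs_prod Omega G delta K : generic_system G delta K ->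
  generic_system [set Q : set (W * Omega) | ae [set b | G [set w | Q (b, w)]]]
    fst (K * {j : W | j < kappa})%type.
Proof.
move=> gs; have cG := gs_filter gs.
have GT (Q : set Omega) : (forall w, Q w) -> G Q.
  by move=> Qw; apply: (cfS cG _) (cfT cG) => w _.
split=> /=.
- exact: complete_filter_prod.
- by apply: small_prod; [exact: gs_small gs | exact: small_seg].
- by apply: ae_true => // b bl; apply: GT => w; exact: ltW.
- apply: ae_mono (ae_limit wfW lam_regular I_ideal I_uniform I_normal) => // b _.
  by move=> bP; exact: GT.
- by apply: ae_mono R_ae => // b _ bP; exact: GT.
- move=> b bl; apply: ae_mono (ae_gt lam_regular I_uniform bl) => // c _ bc.
  exact: GT.
- move=> g gl; apply: ae_mono (ae_closed lam_regular I_ideal I_uniform I_normal gl) => //.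
  by move=> c _ bc; exact: GT.
- move=> f fb; have [z z0 _] := wf_zero wfW lam.
  have zl := not_zero_gt0 (regular_limit lam_regular).1 z0.
  have /choice[D DP] : forall b, exists D : K -> W, b < lam -> z < b ->
      G [set w | f (b, w) < b] ->
      (forall k, D k < b) /\ G [set w | exists k, f (b, w) = D k].
    move=> b; have [[bl zb Gb]|nb] :=
      pselect [/\ b < lam, z < b & G [set w | f (b, w) < b]]; last first.
      by exists (fun=> z) => bl zb Gb; exfalso; apply: nb.
    have [|D Dl DP] := gs_few gs (f := fun w => f (b, w)).
      apply: (cfS cG _) (cfI cG Gb (gs_gt gs bl)) => w [/=].
      exact: lt_trans.
    exists (fun k => if D k < b then D k else z) => _ _ _; split.
      by move=> k; case: ifP.
    apply: (cfS cG _) (cfI cG Gb DP) => w [/= fb' [k fk]]; exists k.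
    by rewrite -fk fb'.
  have aeD := ae_and I_ideal (ae_gt lam_regular I_uniform zl) fb.
  have /choice[E EP] : forall k, exists E : {j : W | j < kappa} -> W,
      (forall j, E j < lam) /\ ae [set b | exists j, D b k = E j].
    move=> k; apply: ae_regressive => //.
    by apply: ae_mono aeD => // b bl [zb Gb]; exact: (DP b bl zb Gb).1.
  exists (fun kj => E kj.1 kj.2); first by move=> [k j]; exact: (EP k).1.
  have := (gs_small gs).2 _ _ aeF _ (fun k => (EP k).2).
  move=> /(ae_and I_ideal aeD); apply: ae_mono => // b bl [[zb Gb] Eb].
  apply: (cfS cG _) (DP b bl zb Gb).2 => w [k fk].
  by have [j Dj] := Eb k; exists (k, j); rewrite fk Dj.
Qed.

(* Sets that are k-stationary in the generic extension reflect almost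
   everywhere, in the sense of the ideal of the ground model. *)
Definition reflects_ae (k : W) : Prop := forall Omega G delta K,
  @generic_system Omega G delta K -> forall X : Omega -> set W,
  G [set w | St k (delta w) (X w)] ->
  ae [set b | G [set w | St k b (X w `&` seg b)]].

(** The index [e w] is regressive, hence takes few values; restricting the system to each value
    makes the index constant, and smallness of [K] combines the results. *)
Lemma reflects_ae_var k Omega G delta K (X : Omega -> set W) (e : Omega -> W) :
  (forall j, j < k -> reflects_ae j) -> @generic_system Omega G delta K ->
  G [set w | e w < k] -> G [set w | e w < delta w] ->
  G [set w | St (e w) (delta w) (X w)] ->
  ae [set b | G [set w | St (e w) b (X w `&` seg b)]].
Proof.
move=> IH gs ek ed eX; have cG := gs_filter gs.
have [D Dl DP] := gs_few gs ed.
have Dae c : ae [set b | G [set w | e w = D c -> St (e w) b (X w `&` seg b)]].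
  have [Dk|Dk] := ltP (D c) k; last first.
    apply: ae_true => // b _; apply: (cfS cG _) ek => w /= + eD.
    by rewrite eD ltNge Dk.
  have gs' := gs_restrict [set w | e w = D c] gs.
  have := IH _ Dk _ _ _ _ gs' X; have : G [set w | e w = D c -> St (D c) (delta w) (X w)].
    by apply: (cfS cG _) eX => w + <-.
  move=> GX /(_ GX); apply: ae_mono => // b _; apply: (cfS cG _) => w /= SD eD.
  by rewrite eD; exact: SD.
have := (gs_small gs).2 _ _ aeF _ Dae; apply: ae_mono => // b _ bP.
have := (gs_small gs).2 _ _ cG _ bP => /(cfI cG DP).
by apply: (cfS cG) => w /= [[c ec] wP]; exact: wP ec.
Qed.

(** For [k > 0], witnesses [T w i] against [E] would reflect almost everywhere by induction;
    diagonally, a single [b] in [E] reflects all those with [i < b], for almost all [w] at once. *)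
Lemma ae_stationary k Omega G delta K (E : set W) :
  (forall j, j < k -> reflects_ae j) -> @generic_system Omega G delta K ->
  G [set w | k <= delta w] -> ae E ->
  G [set w | St k (delta w) (E `&` seg (delta w))].
Proof.
move=> IH gs kd aE; have cG := gs_filter gs.
have [k0|k0] := pselect (is_zero k).
  (* [g b] is a point of [E] above [b]; almost all [delta w] are closed under [g]. *)
  have /choice[g gP] : forall b, exists c, b < lam -> [/\ b < c, c < lam & E c].
    move=> b; case: (pselect (b < lam)) => [bl|nb]; last by exists b.
    have [c cl [bc Ec]] :=
      ae_ex I_ideal (ae_and I_ideal (ae_gt lam_regular I_uniform bl) aE).
    by exists c.
  have gl b : b < lam -> g b < lam by move=> /gP[].
  have GP := cfI cG (gs_limit gs) (cfI cG (gs_R gs) (cfI cG (gs_le gs) (gs_closed gs gl))).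
  apply: (cfS cG _) GP => w /= [dlim [Rd [dl gd]]].
  apply/(rn_eq rn); split=> // _; split=> // b bd.
  have [bg _ Eg] := gP b (lt_le_trans bd dl).
  by exists (g b); [split=> //; exact: gd | exact: ltW].
pose B w := ~ St k (delta w) (E `&` seg (delta w)).
have /choice[pTe wP] : forall w, exists pTe : W * (W -> set W) * (W -> W),
    B w -> is_limit (delta w) -> [/\ okP pTe.1.1,
      forall i, N pTe.1.1 (delta w) i ->
        pTe.2 i < k /\ St (pTe.2 i) (delta w) (pTe.1.2 i)
    & ~ reflects_at (E `&` seg (delta w)) (fun b => forall i, N pTe.1.1 b i ->
        pTe.2 i < k /\ St (pTe.2 i) b (pTe.1.2 i `&` seg b))].
  move=> w; have [[Bw dlim]|nw] := pselect (B w /\ is_limit (delta w)); last first.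
    by exists (lam, (fun=> set0), (fun=> lam)) => Bw dlim; case: nw.
  apply: contrapT => nw; apply: Bw; apply/(rn_eq rn); split=> // _.
  move=> p okp T e eT; apply: contrapT => nr; apply: nw.
  by exists (p, T, e).
pose p w := (pTe w).1.1; pose T w := (pTe w).1.2; pose e w := (pTe w).2.
have aeT i : i < lam -> ae [set b | G [set w | B w /\ N (p w) (delta w) i ->
    St (e w i) b (T w i `&` seg b)]].
  move=> il; have gs' := gs_restrict [set w | B w /\ N (p w) (delta w) i] gs.
  apply: (reflects_ae_var IH gs') => /=.
  - apply: (cfS cG _) (gs_limit gs) => w /= dlim [Bw Ni].
    by have [_ /(_ _ Ni)[]] := wP w Bw dlim.
  - apply: (cfS cG _) (cfI cG kd (gs_limit gs)) => w /= [kw dlim] [Bw Ni].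
    have [_ /(_ _ Ni)[ek _] _] := wP w Bw dlim.
    exact: lt_le_trans kw.
  - apply: (cfS cG _) (gs_limit gs) => w /= dlim [Bw Ni].
    by have [_ /(_ _ Ni)[]] := wP w Bw dlim.
have [b bl [aeTb [Eb [chib blim]]]] := ae_ex I_ideal
  (ae_and I_ideal (ae_diag I_ideal I_normal aeT) (ae_and I_ideal aE
  (ae_and I_ideal (ae_gt lam_regular I_uniform chi_lam)
    (ae_limit wfW lam_regular I_ideal I_uniform I_normal)))).
have := cf_lt cG bl aeTb.
move=> /(cfI cG (cfI cG (gs_gt gs bl) (gs_limit gs))); apply: (cfS cG).
move=> w /= [[bd dlim] TP]; apply: contrapT => Bw.
have [okp eT []] := wP w Bw dlim; exists b; split=> // i Ni.
have Nd := rn_anti rn okp (ltW bd) Ni; split; first by have [] := eT i Nd.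
exact: TP i (rn_seg rn okp blim chib Ni) (conj Bw Nd).
Qed.

Lemma gs_bounded Omega G delta K (f : Omega -> W) :
  @generic_system Omega G delta K -> G [set w | f w < delta w] ->
  exists2 r, r < lam & G [set w | f w < r].
Proof.
move=> gs fd; have [D Dl DP] := gs_few gs fd.
have [r rl Dr] := (gs_small gs).1 D Dl; exists r => //.
by apply: cfS (gs_filter gs) _ _ _ DP => w [k /= ->].
Qed.

(** A point of [X w] above [b] can be bounded by some [r b] independent of [w]; almost all ordinals
    are closed under [r]. *)
Lemma reflects_ae0 k : is_zero k -> reflects_ae k.
Proof.
move=> k0 Omega G delta K gs X GX; have cG := gs_filter gs.
have /choice[f fP] : forall b, exists f : Omega -> W, forall w,
    St k (delta w) (X w) -> b < delta w -> X w (f w) /\ b < f w.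
  move=> b; have /choice[f fP] : forall w, exists x,
      St k (delta w) (X w) -> b < delta w -> X w x /\ b < x.
    move=> w; have [[SX bd]|nw] := pselect (St k (delta w) (X w) /\ b < delta w);
      last by exists b => SX bd; case: nw.
    have [_ Xu] := St_zero rn k0 SX.
    have [x Xx bx] := (unbounded_inP (St_limit rn SX) (St_seg rn SX)).1 Xu _ bd.
    by exists x.
  by exists f.
have /choice[r rP] : forall b, exists r, b < lam -> r < lam /\ G [set w | f b w < r].
  move=> b; have [bl|nb] := pselect (b < lam); last by exists b.
  have [|r rl Gr] := gs_bounded (f := f b) gs; last by exists r.
  apply: (cfS cG _) (cfI cG GX (gs_gt gs bl)) => w /= [SX bd].
  exact: (St_seg rn SX) (fP b w SX bd).1.
have := ae_closed lam_regular I_ideal I_uniform I_normal (fun b bl => (rP b bl).1).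
move=> /(ae_and I_ideal R_ae).
move=> /(ae_and I_ideal (ae_limit wfW lam_regular I_ideal I_uniform I_normal)).
apply: ae_mono => // b bl [blim [Rb rb]].
have Gf : G [set w | forall c, c < b -> f c w < r c].
  by apply: (cf_lt cG bl) => c cb; have [] := rP c (lt_trans cb bl).
apply: (cfS cG _) (cfI cG (cfI cG GX (gs_gt gs bl)) Gf) => w /= [[SX bd] fr].
apply/(rn_eq rn); split=> // _; split=> // c cb.
have [Xf cf] := fP c w SX (lt_trans cb bd).
exists (f c w); last exact: ltW.
by split=> //; exact: lt_trans (fr c cb) (rb c cb).
Qed.

(* If the sets [X w] did not reflect to [b] for positively many [b], take
   witnesses [T b w i].  By induction these reflect at almost all [x], so one
   set [E] of the dual filter, stationary in [delta w], is contained in all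
   their traces; reflecting [E] at a point of [X w], which is bounded
   independently of [b], reflects the witnesses at this point. *)
Lemma reflects_ae_lt k : k < lam -> reflects_ae k.
Proof.
move: k; apply: (well_founded_ind wfW) => k IH kl.
have [k0|k0] := pselect (is_zero k); first exact: reflects_ae0.
have {}IH j : j < k -> reflects_ae j by move=> jk; apply: IH (lt_trans jk kl).
have [q [mu cov]] := rn_cov rn kl k0.
move=> Omega G delta K gs X GX; have cG := gs_filter gs.
have aelim := ae_limit wfW lam_regular I_ideal I_uniform I_normal.
pose B b w := ~ St k b (X w `&` seg b).
have /choice[pTe wP] : forall bw : W * Omega,
    exists pTe : W * (W -> set W) * (W -> W),
    B bw.1 bw.2 -> is_limit bw.1 -> [/\ okP pTe.1.1,
      forall i, N pTe.1.1 bw.1 i ->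
        pTe.2 i < k /\ St (pTe.2 i) bw.1 (pTe.1.2 i)
    & ~ reflects_at (X bw.2 `&` seg bw.1) (fun b => forall i, N pTe.1.1 b i ->
        pTe.2 i < k /\ St (pTe.2 i) b (pTe.1.2 i `&` seg b))].
  move=> [b w] /=; have [[Bw blim]|nw] := pselect (B b w /\ is_limit b); last first.
    by exists (lam, (fun=> set0), (fun=> lam)) => Bw blim; case: nw.
  apply: contrapT => nw; apply: Bw; apply/(rn_eq rn); split=> // _.
  move=> p okp T e eT; apply: contrapT => nr; apply: nw.
  by exists (p, T, e).
pose p bw := (pTe bw).1.1; pose T bw := (pTe bw).1.2; pose e bw := (pTe bw).2.
pose U i x b := G [set w | B b w /\ N (p (b, w)) b i ->
  St (e (b, w) i) x (T (b, w) i `&` seg x)].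
(* The induction hypothesis is applied to the product system, restricted to the pairs where
   reflection fails and [i] is an index. *)
have aeU i : i < lam -> ae [set x | ae [set b | U i x b]].
  move=> il; have gs' := gs_restrict
    [set bw : W * Omega | B bw.1 bw.2 /\ N (p bw) bw.1 i] (gs_prod gs).
  have all_w (Q : set Omega) : (forall w, Q w) -> G Q.
    by move=> Qw; apply: (cfS cG _) (cfT cG) => w _.
  apply: (reflects_ae_var (X := fun bw => T bw i) (e := fun bw => e bw i) IH gs').
  - apply: ae_mono aelim => // b _ blim; apply: all_w => w /= [Bw Ni].
    by have [_ /(_ _ Ni)[]] := wP (b, w) Bw blim.
  - apply: ae_mono (ae_and I_ideal aelim (ae_gt lam_regular I_uniform kl)) => //.
    move=> b _ [blim kb]; apply: all_w => w /= [Bw Ni].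
    have [_ /(_ _ Ni)[ek _] _] := wP (b, w) Bw blim.
    exact: lt_trans kb.
  - apply: ae_mono aelim => // b _ blim; apply: all_w => w /= [Bw Ni].
    by have [_ /(_ _ Ni)[]] := wP (b, w) Bw blim.
pose E := [set x | [/\ chi < x, k < x & forall i, i < x -> ae [set b | U i x b]]].
have aeE : ae E.
  apply: ae_mono (ae_and I_ideal (ae_diag I_ideal I_normal aeU) (ae_and I_ideal
    (ae_gt lam_regular I_uniform chi_lam) (ae_gt lam_regular I_uniform kl))) => //.
  by move=> x _ [Ux [chix kx]].
pose good w := St k (delta w) (X w) /\
  forall j, j < k -> St j (delta w) (E `&` seg (delta w)).
have Ggood : G [set w | good w].
  apply: (cfI cG GX); apply: (cf_lt cG kl) => j jk; apply: (ae_stationary _ gs) => //.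
    by move=> i ij; exact: IH (lt_trans ij jk).
  apply: (cfS cG _) (gs_gt gs (lt_trans jk kl)) => w /=; exact: ltW.
(* [f m w] is a point of [X w] reflecting [E] with shape [q m], chosen without reference to [b]. *)
have /choice[f fP] : forall m, exists f : Omega -> W, forall w, m < k -> good w ->
    [/\ X w (f w), is_limit (f w) & forall j, N (q m) (f w) j ->
      St (mu m j) (f w) (E `&` seg (f w))].
  move=> m; suff /choice[f fP] : forall w, exists x, m < k -> good w ->
    [/\ X w x, is_limit x & forall j, N (q m) x j -> St (mu m j) x (E `&` seg x)].
    by exists f.
  move=> w; have [[mk [SX SE]]|nw] := pselect (m < k /\ good w); last first.
    by exists m => mk gw; case: nw.
  have [_ Xd _ X1] := (rn_eq rn _ _ _).1 SX.
  have [|g [Xg glim gP]] := X1 k0 _ (cov_ok cov mk)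
      (fun=> E `&` seg (delta w)) (mu m).
    by move=> j _; split; [|apply: SE]; exact: (cov_lt cov).
  exists g => _ _; split=> // j /gP[_].
  suff -> : E `&` seg (delta w) `&` seg g = E `&` seg g by [].
  apply/seteqP; split=> [z [[Ez _] zg]|z [Ez zg]] //.
  by split=> //; split=> //; exact: lt_trans zg (Xd _ Xg).
have /choice[r rP] : forall m, exists r, m < k -> r < lam /\ G [set w | f m w < r].
  move=> m; have [mk|nm] := pselect (m < k); last by exists m.
  have [|r rl Gr] := gs_bounded (f := f m) gs; last by exists r.
  apply: (cfS cG _) Ggood => w /= gw; have [Xf _ _] := fP m w mk gw.
  by have [SX _] := gw; exact: (St_seg rn SX) Xf.
have [rho rhol rrho] := regular_bounded lam_regular kl (fun m mk => (rP m mk).1).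
(* Each [x] in [E] is suitable for almost all [b]; the diagonal intersection then handles all
   [x < b] in [E] at once. *)
have aeUE x : x < lam -> ae [set b | E x -> forall i, i < x -> U i x b].
  move=> xl; have [Ex|nEx] := pselect (E x); last by apply: ae_true => // b _ /nEx.
  have [_ _ Ux] := Ex; have := cf_lt aeF xl Ux.
  by apply: ae_mono => // b _ Ub _.
have := ae_and I_ideal (ae_and I_ideal aelim (ae_gt lam_regular I_uniform rhol))
  (ae_diag I_ideal I_normal aeUE).
apply: ae_mono => // b bl [[blim rhob] Ub].
have GU : G [set w | forall x, x < b -> E x -> forall i, i < x ->
    B b w /\ N (p (b, w)) b i -> St (e (b, w) i) x (T (b, w) i `&` seg x)].
  apply: (cf_lt cG bl) => x xb; have [Ex|nEx] := pselect (E x); last first.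
    by apply: (cfS cG _) (cfT cG) => w _ /nEx.
  have := cf_lt cG (lt_trans xb bl) (Ub x xb Ex).
  by apply: (cfS cG) => w wU _.
have Gf := cf_lt cG kl (fun m mk => (rP m mk).2).
apply: (cfS cG _) (cfI cG Ggood (cfI cG GU Gf)) => w /= [gw [wU fr]].
apply: contrapT => Bw; have [okp eT []] := wP (b, w) Bw blim.
have [m mk covm] := cov_ge cov okp (fun i Ni => (eT i Ni).1).
have [Xf flim fE] := fP m w mk gw.
have fb : f m w < b by apply: lt_trans rhob; exact: lt_trans (fr m mk) (rrho m mk).
exists (f m w); split=> // i Ni.
have Nb j : N (p (b, w)) (f m w) j -> N (p (b, w)) b j.
  by apply: (rn_anti rn) => //; exact: ltW.
split; first by have [] := eT i (Nb i Ni).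
apply: (reflect_family wfW rn cov okp flim mk _ (covm _ fb) fE Ni) => x Ex xf.
have [chix kx _] := Ex; split=> // j jx Nj.
by apply: wU => //; [exact: lt_trans fb | split=> //; exact: Nb].
Qed.

End GenericSystem.

(** * The ideals of non-stationary sets *)

Section Conclusion.
Context d (W : orderType d) (wfW : well_founded (fun x y : W => x < y)).
Context (lam kappa chi : W) (I : set (set W)).
Context (lam_regular : is_regular lam) (kappa_lam : kappa < lam)
  (chi_lam : chi < lam)
  (I_ideal : proper_ideal lam I) (I_uniform : uniform_ideal lam I)
  (I_normal : normal_ideal lam I) (I_saturated : saturated_ideal lam kappa I).

Notation ae := (ae lam I).

Section Notion.
Context (okP : set W) (N : W -> W -> set W) (R : set W)
  (St : W -> W -> set W -> Prop).
Context (rn : reflection_notion chi lam okP N R St).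
Context (R_lam : R lam) (R_ae : ae R).

(** The case [k = lam] is included, since [delta] is constantly [lam] in the one-point system and
    [ae_stationary] uses reflection only for indices below [k]. *)
Lemma dual_St k (E : set W) : k <= lam -> ae E -> St k lam (E `&` seg lam).
Proof.
move=> kl aE; have gs := gs_point lam_regular R_lam.
have IH j : j < k -> reflects_ae lam I R St j.
  move=> jk; exact: (reflects_ae_lt wfW lam_regular kappa_lam chi_lam I_ideal
    I_uniform I_normal I_saturated rn R_ae (lt_le_trans jk kl)).
exact: (ae_stationary wfW lam_regular chi_lam I_ideal I_uniform I_normal rn IH
  gs kl aE).
Qed.

Lemma St_ae k (A : set W) : k < lam -> St k lam A ->
  ae [set b | St k b (A `&` seg b)].
Proof.
move=> kl SA; have gs := gs_point lam_regular R_lam.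
have := reflects_ae_lt wfW lam_regular kappa_lam chi_lam I_ideal I_uniform
  I_normal I_saturated rn R_ae kl gs.
by move=> /(_ (fun=> A) SA).
Qed.

(** For [k > 0], witnesses against [A] and against [B] reflect almost everywhere, so one set [E] of
    the dual filter serves both. A point of the union reflecting [E] lies in [A] or [B] and reflects
    the corresponding family, a contradiction. *)
Lemma St_setU k (A B : set W) : k < lam -> A `<=` seg lam -> B `<=` seg lam ->
  St k lam (A `|` B) -> St k lam A \/ St k lam B.
Proof.
move=> kl Al Bl SAB; apply: contrapT => /not_orP[nA nB].
have llim := regular_limit lam_regular.
have [k0|k0] := pselect (is_zero k).
  have notunb C : C `<=` seg lam -> ~ St k lam C -> ~ unbounded_in lam C.
    by move=> Cl nC Cu; apply: nC; apply/(rn_eq rn).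
  have /existsNP[a /not_implyP[al nAa]] := notunb _ Al nA.
  have /existsNP[b /not_implyP[bl nBb]] := notunb _ Bl nB.
  have mab : Order.max a b < lam by rewrite gt_max al.
  have [c ABc] := (St_zero rn k0 SAB).2 _ mab.
  rewrite ge_max => /andP[ac bc].
  by case: ABc => [Ac|Bc]; [apply: nAa | apply: nBb]; exists c.
have [q [mu cov]] := rn_cov rn kl k0.
have witness C : C `<=` seg lam -> ~ St k lam C ->
    exists p (T : W -> set W) e, [/\ okP p,
      forall i, N p lam i -> e i < k /\ St (e i) lam (T i)
    & ~ reflects_at C (fun b => forall i, N p b i ->
        e i < k /\ St (e i) b (T i `&` seg b))].
  move=> Cl nC; apply: contrapT => nw; apply: nC; apply/(rn_eq rn); split=> //.
  move=> _ p okp T e eT; apply: contrapT => nr; apply: nw.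
  by exists p, T, e.
have trace p (T : W -> set W) e :
    (forall i, N p lam i -> e i < k /\ St (e i) lam (T i)) ->
    ae [set x | forall i, i < x -> N p lam i -> St (e i) x (T i `&` seg x)].
  move=> eT; apply: ae_diag => // i il.
  have [/eT[ek Se]|nNi] := pselect (N p lam i); last first.
    by apply: ae_true => // x _ /nNi.
  by apply: ae_mono (St_ae (lt_trans ek kl) Se) => // x _ Sx _.
have [p [T [e [okp eT nr]]]] := witness A Al nA.
have [p' [T' [e' [okp' eT' nr']]]] := witness B Bl nB.
pose E := [set x | [/\ chi < x, k < x,
  forall i, i < x -> N p lam i -> St (e i) x (T i `&` seg x)
  & forall i, i < x -> N p' lam i -> St (e' i) x (T' i `&` seg x)]].
have aeE : ae E.
  apply: ae_mono (ae_and I_ideal (ae_and I_ideal (trace _ _ _ eT) (trace _ _ _ eT'))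
    (ae_and I_ideal (ae_gt lam_regular I_uniform chi_lam)
      (ae_gt lam_regular I_uniform kl))) => //.
  by move=> x _ [[xT xT'] [chix kx]].
have [m mk covm] := cov_ge cov okp (fun i Ni => (eT i Ni).1).
have [m' mk' covm'] := cov_ge cov okp' (fun i Ni => (eT' i Ni).1).
(* One shape covers the indices of both families. *)
have [n nk dir] := cov_directed cov mk mk'.
have [_ ABl _ AB1] := (rn_eq rn _ _ _).1 SAB.
have [|g [ABg glim gP]] := AB1 k0 _ (cov_ok cov nk) (fun=> E `&` seg lam) (mu n).
  move=> j _; have mk'' := cov_lt cov j nk; split=> //.
  exact: dual_St (ltW (lt_trans mk'' kl)) aeE.
have gl : g < lam := ABl _ ABg.
have Sg j : N (q n) g j -> St (mu n j) g (E `&` seg g).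
  move=> /gP[_]; suff -> : E `&` seg lam `&` seg g = E `&` seg g by [].
  apply/seteqP; split=> [z [[Ez _] zg]|z [Ez zg]] //.
  by split=> //; split=> //; exact: lt_trans gl.
have Nl r i : okP r -> N r g i -> N r lam i.
  by move=> okr; apply: (rn_anti rn) => //; exact: ltW.
case: ABg => [Ag|Bg]; [apply: nr | apply: nr']; exists g; split=> // i Ni.
  split; first by have [] := eT i (Nl _ _ okp Ni).
  apply: (reflect_family wfW rn cov okp glim nk _ _ Sg Ni).
    by move=> x [chix kx xT _] xg; split=> // j jx /(Nl _ _ okp); exact: xT.
  move=> chig kg j /(covm g gl chig kg j)[h Nh eh].
  by have [h' Nh' [/(_ Nh) hh' _]] := dir g h (or_introl Nh);
    exists h' => //; exact: le_trans hh'.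
split; first by have [] := eT' i (Nl _ _ okp' Ni).
apply: (reflect_family wfW rn cov okp' glim nk _ _ Sg Ni).
  by move=> x [chix kx _ xT] xg; split=> // j jx /(Nl _ _ okp'); exact: xT.
move=> chig kg j /(covm' g gl chig kg j)[h Nh eh].
by have [h' Nh' [_ /(_ Nh) hh']] := dir g h (or_intror Nh);
  exists h' => //; exact: le_trans hh'.
Qed.

Lemma St_seg_lam k : k <= lam -> St k lam (seg lam).
Proof.
move=> kl; have := @dual_St k setT kl; rewrite setTI; apply.
exact: ae_true.
Qed.

Lemma proper_ideal_nonSt k : k < lam ->
  proper_ideal lam [set A | A `<=` seg lam /\ ~ St k lam A].
Proof.
move=> kl; split; last first.
  move=> /seteqP[_ /(_ (seg lam))]; rewrite /powerset_of /= => -[]//.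
  by move=> _; apply; exact: St_seg_lam (ltW kl).
split=> [A []//||A B [Bl nB] AB|A B [Al nA] [Bl nB]].
- split=> // /(St_unbounded wfW rn R_lam).
  by move=> /(unbounded_limit_neq0 wfW (regular_limit lam_regular))[].
- split=> [x /AB /Bl//|SA]; apply: nB; exact: (St_superset rn AB Bl SA).
- rewrite joinEset; split=> [x [/Al|/Bl]//|SAB].
  by have [] := St_setU kl Al Bl SAB.
Qed.

End Notion.
End Conclusion.

(** * The three notions as instances *)

Section Instances.
Context d (W : orderType d) (wfW : well_founded (fun x y : W => x < y)).
Implicit Types (a b k lam chi : W).

(** The least ordinal is the only index, so a family is a single set. *)
Lemma stationary_notion chi lam :
  reflection_notion chi lam setT (fun _ _ => @is_zero _ W) setT (stationary wfW).
Proof.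
have [z z0 zle] := wf_zero wfW lam.
split=> //=.
- move=> k a A; split=> [/hierarchyE[alim Aa A0 A1]|[alim Aa A0 A1]].
    split=> // [/A0 /limit_supremumP - /(_ alim Aa)//|k0 _ _ T e eT].
    have [b [Ab blim [ek Sb]]] := A1 k0 (e z) (T z) (eT z z0).
    exists b; split=> // i i0; suff -> : i = z by [].
    by apply/le_anti; rewrite zle is_zero_le.
  apply/hierarchyE; split=> // [/A0[_ Au]|k0 e S [ek SS]].
    exact/limit_supremumP.
  have [|b [Ab blim bP]] := A1 k0 z I (fun=> S) (fun=> e) => //.
  by exists b; split=> //; exact: bP z z0.
- by exists lam => // a _; exists z.
- by move=> p a b _ _.
- by move=> p a _ [anz _] _ i i0; exact: not_zero_gt0.
- by right=> a _; split=> // p _; exists z.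
- move=> k kl k0; exists id, (fun m _ => m); split=> //=.
  + by move=> m g _ _; exists z => //; right.
  + move=> p b e _ ek; exists (e z); first exact: ek.
    move=> g _ _ _ i i0; exists z => //; suff -> : i = z by [].
    by apply/le_anti; rewrite zle is_zero_le.
  + move=> m m' mk mk'; exists (Order.max m m'); first by rewrite gt_max mk.
    by move=> g j [] j0; exists j => //; rewrite !le_max !lexx orbT.
Qed.

(** In any [g > k], one family lists all indices below [k]: index [j] at place [j]. *)
Lemma d_stationary_notion chi lam :
  reflection_notion chi lam setT (fun _ a => seg a) setT (d_stationary wfW).
Proof.
have [z z0 zle] := wf_zero wfW lam.
have segz a : is_limit a -> seg a z by move=> [anz _]; exact: not_zero_gt0.
split=> //=.
- move=> k a A; split=> [/hierarchyE[alim Aa A0 A1]|[alim Aa A0 A1]].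
    by split=> // [/A0//|k0 _ _ T e eT]; exact: A1.
  apply/hierarchyE; split=> // [/A0[]//|k0 T e eT].
  exact: A1 k0 z I T e eT.
- by exists lam => // a alim; exists z; exact: segz.
- by move=> p a b _ ab i ia; exact: lt_le_trans ab.
- by move=> p a _ _ _.
- by right=> a alim; split=> // p _; exists z; exact: segz.
- move=> k kl k0; exists id, (fun _ j => if j < k then j else z).
  have zk := not_zero_gt0 k0 z0; split=> //=.
  + by move=> m j _; case: ifP.
  + by move=> m g _ glim; exists z; [exact: segz | right].
  + move=> p b e _ ek; exists z => // g gb _ kg i ig.
    have eik := ek i (lt_trans ig gb).
    by exists (e i); [exact: lt_trans kg | rewrite eik].
  + by move=> m m' mk _; exists m => // g j [] jg; exists j.
Qed.

(** If fewer than [chi] indices below [k] are always bounded below [k], the indices 0 and [m]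
    suffice; otherwise a cofinal sequence of length [p < chi] is used, together with 0. The index 0
    serves [cov_base]. *)
Lemma s_stationary_notion chi lam : is_regular chi ->
  reflection_notion chi lam (seg chi) (fun p _ => seg p)
    [set a | forall B, B `<=` seg a -> unbounded_in a B -> seg chi #<= B]
    (s_stationary wfW chi).
Proof.
move=> /regular_limit [chi0 chilim].
have [z z0 zle] := wf_zero wfW chi; have zchi := not_zero_gt0 chi0 z0.
have [one z1 onechi] := chilim z zchi.
split=> //=.
- move=> k a A; split=> [/hierarchyE[alim Aa A0 A1]|[alim Aa A0 A1]].
    split=> // /A0[Au Acof].
    by split=> //; exact/(unbounded_in_cof_geP _ Aa Au).
  apply/hierarchyE; split=> // /A0[Ra Au].
  by split=> //; exact/(unbounded_in_cof_geP _ Aa Au).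
- by exists one => // a _; exists z.
- by move=> p a b _ _.
- by move=> p a pchi _ chia i ip; exact: lt_trans ip (lt_trans pchi chia).
- by left=> p _ pchi i ip; exact: lt_trans ip pchi.
- move=> k kl k0; have zk := not_zero_gt0 k0 z0.
  have [bounded|unbounded] := pselect (forall p (e : W -> W), p < chi ->
      (forall i, i < p -> e i < k) -> exists2 m, m < k & forall i, i < p -> e i <= m).
    have [two onetwo twochi] := chilim one onechi.
    exists (fun=> two), (fun m j => if `[< is_zero j >] then z else m).
    split=> //=.
    + by move=> m j mk; case: asboolP.
    + move=> m g mk _; exists z; first exact: lt_trans onetwo.
      by left; case: asboolP.
    + move=> p b e pchi ek; have [m mk em] := bounded p e pchi ek.
      exists m => // g _ _ _ i ip; exists one => //.
      by case: asboolP => [/(_ z)//|_]; exact: em.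
    + move=> m m' mk mk'; exists (Order.max m m'); first by rewrite gt_max mk.
      move=> g j _; exists one => //.
      case: (asboolP (is_zero one)) => [/(_ z)//|_].
      by case: asboolP => _; rewrite !le_max ?lexx ?zle ?orbT.
  have [p [e [pchi ek eunb]]] : exists p (e : W -> W), [/\ p < chi,
      forall i, i < p -> e i < k & forall m, m < k -> exists2 i, i < p & m <= e i].
    apply: contrapT => nope; apply: unbounded => p e pchi ek.
    apply: contrapT => ne; apply: nope; exists p, e; split=> // m mk.
    apply: contrapT => nm; apply: ne; exists m => // i ip.
    by rewrite leNgt; apply/negP => me; apply: nm; exists i => //; exact: ltW.
  (* Taking [q > p] leaves place [p] free for the index 0. *)
  have [q pq qchi] := chilim p pchi.
  exists (fun=> q), (fun _ j => if j < p then e j else z); split=> //=.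
  + by move=> m j _; case: ifP => // /ek.
  + by move=> m g _ _; exists p => //; left; rewrite ltxx.
  + move=> r b f _ fk; exists z => // g _ _ _ i ir.
    have [j jp fe] := eunb _ (fk i ir).
    by exists j; [exact: lt_trans pq | rewrite jp].
  + by move=> m m' mk _; exists m => // g j [] jq; exists j.
Qed.

End Instances.

(** * The cofinality of almost all ordinals below [lam] *)

Section Cofinality.
Context d (W : orderType d) (wfW : well_founded (fun x y : W => x < y)).
Context (lam kappa chi : W) (I : set (set W)).
Context (lam_regular : is_regular lam) (kappa_lam : kappa < lam)
  (chi_lam : chi < lam)
  (I_ideal : proper_ideal lam I) (I_uniform : uniform_ideal lam I)
  (I_normal : normal_ideal lam I) (I_saturated : saturated_ideal lam kappa I).

Lemma cof_lam (B : set W) : B `<=` seg lam -> unbounded_in lam B ->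
  seg chi #<= B.
Proof.
move=> Bl Bu; have [_ _ lamcof] := lam_regular.
apply: (card_le_trans (B := seg lam)); last by apply: lamcof; split.
by apply: subset_card_le => x xchi; exact: lt_trans chi_lam.
Qed.

(** Where the cofinality is below [chi], enumerate a short unbounded set. Its [i]-th point is
    regressive in [a], hence bounded almost everywhere; regularity of [lam] yields a bound [rho] for
    all [i < chi], impossible once [a > rho]. *)
Lemma ae_cof : ae lam I
  [set a | forall B, B `<=` seg a -> unbounded_in a B -> seg chi #<= B].
Proof.
have [z z0 _] := wf_zero wfW lam.
have zl := not_zero_gt0 (regular_limit lam_regular).1 z0.
pose R (a : W) := forall B, B `<=` seg a -> unbounded_in a B -> seg chi #<= B.
have /choice[jh jhP] : forall a, exists jh : W * (W -> W) * set W, ~ R a -> [/\ jh.1.1 < chi,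
    jh.2 `<=` seg a, unbounded_in a jh.2 & jh.2 `<=` jh.1.2 @` seg jh.1.1].
  move=> a; have [Ra|] := pselect (R a).
    by exists (lam, id, set0) => /(_ Ra).
  move=> /existsNP[B /not_implyP[Ba /not_implyP[Bu nB]]].
  have [[f fB finj]|[j jchi [f fP]]] := seg_injection_or_image wfW chi B.
    case: nB; apply: (card_le_trans (B := f @` seg chi)); last first.
      by apply: subset_card_le => _ [j jchi <-]; exact: fB.
    have : f @` seg chi #= seg chi by exact: inj_card_eq.
    by rewrite card_eq_le => /andP[].
  by exists (j, f, B).
pose f i a := if `[< (jh a).1.2 i < a >] then (jh a).1.2 i else z.
have /choice[r rP] : forall i, exists r, r < lam /\ ae lam I [set a | f i a < r].
  move=> i; have [|D [Dl Df]] :=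
      ae_regressive wfW I_ideal I_normal I_saturated (f := f i).
    apply: ae_mono (ae_gt lam_regular I_uniform zl) => // a _ za.
    by rewrite /= /f; case: asboolP.
  have [r rl Dr] := (small_seg wfW lam_regular kappa_lam).1 D Dl.
  by exists r; split=> //; apply: ae_mono Df => // a _ [k /= ->].
have [rho rhol rrho] := regular_bounded lam_regular chi_lam (fun i _ => (rP i).1).
have cF := ae_complete_filter lam_regular I_ideal I_uniform I_normal.
have := cf_lt cF chi_lam (fun i _ => (rP i).2).
move=> /(ae_and I_ideal (ae_gt lam_regular I_uniform rhol)).
apply: ae_mono => // a _ [rhoa fr]; apply: contrapT => /jhP[jchi Ba Bu Bf].
have [c Bc] := Bu _ rhoa; rewrite leNgt => /negP; apply.
have ca := Ba _ Bc; have [i ij hc] := Bf _ Bc; have ichi := lt_trans ij jchi.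
have := fr i ichi; rewrite /= /f hc; case: asboolP => // _ cr.
exact: lt_trans cr (rrho i ichi).
Qed.

End Cofinality.

Theorem theorem3p3 (d : Order.disp_t) (W : orderType d)
    (wfW : well_founded (fun x y : W => (x < y)%O))
    (lam kappa chi : W) (I : set (set W))
    (lam_regular : is_regular lam)
    (kappa_cardinal : is_cardinal kappa) (kappa_lam : (kappa < lam)%O)
    (I_ideal : proper_ideal lam I)
    (I_uniform : uniform_ideal lam I)
    (I_normal : normal_ideal lam I)
    (I_saturated : saturated_ideal lam kappa I)
    (chi_regular : is_regular chi) (chi_lam : (chi < lam)%O) :
  (forall k : W, (k < lam)%O ->
     [/\ proper_ideal lam (NS wfW k lam),
         proper_ideal lam (NS_s wfW k chi lam)
       & proper_ideal lam (NS_d wfW k lam)])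
  /\ [/\ ord_stationary wfW lam lam,
         ord_s_stationary wfW lam chi lam
       & ord_d_stationary wfW lam lam].
Proof.
(* [R] has to hold at [lam] and almost everywhere: trivially if it is [setT], and by the cofinality
   lemmas for s-stationarity. *)
have aeT : ae lam I setT by exact: ae_true.
have aeR := ae_cof wfW lam_regular kappa_lam chi_lam I_ideal I_uniform I_normal
  I_saturated.
have Rl := cof_lam lam_regular chi_lam.
have n0 := stationary_notion wfW chi lam.
have ns := s_stationary_notion wfW lam chi_regular.
have nd := d_stationary_notion wfW chi lam.
split=> [k kl|]; split.
- exact: (proper_ideal_nonSt wfW lam_regular kappa_lam chi_lam I_ideal I_uniform
    I_normal I_saturated n0).
- exact: (proper_ideal_nonSt wfW lam_regular kappa_lam chi_lam I_ideal I_uniform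
    I_normal I_saturated ns).
- exact: (proper_ideal_nonSt wfW lam_regular kappa_lam chi_lam I_ideal I_uniform
    I_normal I_saturated nd).
- exact: (St_seg_lam wfW lam_regular kappa_lam chi_lam I_ideal I_uniform
    I_normal I_saturated n0).
- exact: (St_seg_lam wfW lam_regular kappa_lam chi_lam I_ideal I_uniform
    I_normal I_saturated ns).
- exact: (St_seg_lam wfW lam_regular kappa_lam chi_lam I_ideal I_uniform
    I_normal I_saturated nd).
Qed.
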